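(* Assume the axiom of choice. For every set $S$ there is a $T_2$-anonymous predictor $P:{}^{\mathbb{R}}S\to{}^{\mathbb{R}}S$ such that for every scenario $f\in{}^{\mathbb{R}}S$, the set $\{x\in\mathbb{R}: P(f)(x)\neq f(x)\}$ is countable.
   Context: For a set $S$, ${}^{\mathbb{R}}S$ is the set of all functions (scenarios) $f:\mathbb{R}\to S$. A predictor is a function $P:{}^{\mathbb{R}}S\to{}^{\mathbb{R}}S$ such that for all $f,g\in{}^{\mathbb{R}}S$ and all $x\in\mathbb{R}$, if $f\upharpoonright(-\infty,x)=g\upharpoonright(-\infty,x)$ then $P(f)(x)=P(g)(x)$. For a family $T$ of functions $\mathbb{R}\to\mathbb{R}$, a predictor $P$ is $T$-anonymous if $P(f\circ t)=P(f)\circ t$ for every scenario $f$ and every $t\in T$. $T_2$ is the set of all functions $t:\mathbb{R}\to\mathbb{R}$ of the form $t(y)=ay+c$ with $a>0$, $c\in\mathbb{R}$. *)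

(* Defs.v *)
From Stdlib Require Export Reals.
Open Scope R_scope.

Definition predictor {S : Type} (P : (R -> S) -> (R -> S)) : Prop :=
  forall (f g : R -> S) (x : R),
    (forall y : R, y < x -> f y = g y) -> P f x = P g x.

Definition in_T2 (t : R -> R) : Prop :=
  exists a c : R, 0 < a /\ forall y : R, t y = a * y + c.

Definition anonymous {S : Type} (T : (R -> R) -> Prop)
  (P : (R -> S) -> (R -> S)) : Prop :=
  forall (f : R -> S) (t : R -> R), T t ->
    P (fun y => f (t y)) = (fun y => P f (t y)).

Definition countable_set (A : R -> Prop) : Prop :=
  exists g : R -> nat, forall x y : R, A x -> A y -> g x = g y -> x = y.

(* Main.v *)
Require Import Defs.
From Stdlib Require Import Reals.
From Stdlib Require Import Lra Lia Cantor Classical.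
From Stdlib Require Import IndefiniteDescription FunctionalExtensionality.
From mathcomp Require eqtype boolp wochoice.
Open Scope R_scope.

(** Call [f] self-similar at [x] if [f o t = f] on [(-oo, x)] for some affine
    increasing [t] with [t x < x]; the value [f (t x)] does not depend on [t]
    (the commutator of two such maps is a translation, so when they do not
    commute [f] is periodic on [(-oo, x)]) and is taken as the prediction.  It
    is wrong at most twice.  Otherwise well-order the scenarios, let [m] be the
    least one such that [m o r = f] on [(-oo, x)] for some affine increasing
    [r], and predict [m (r x)]; this does not depend on [r], because two choices
    with different values would make [f] self-similar at [x].  As [x] increases
    over the errors of the second kind, [m] strictly increases, so these errors
    are well-ordered by [<]. *)

(** * Increasing affine maps *)

Lemma in_T2_id : in_T2 (fun y => y).
Proof. exists 1, 0. split; intros; lra. Qed.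

Lemma in_T2_comp (s t : R -> R) :
  in_T2 s -> in_T2 t -> in_T2 (fun y => s (t y)).
Proof.
  intros [a [b [Ha Hs]]] [c [d [Hc Ht]]].
  exists (a * c), (a * d + b). split.
  - now apply Rmult_lt_0_compat.
  - intros y. rewrite Hs, Ht. ring.
Qed.

Lemma in_T2_inv (t : R -> R) :
  in_T2 t ->
  exists r, in_T2 r /\ (forall y, t (r y) = y) /\ (forall y, r (t y) = y).
Proof.
  intros [a [c [Ha Ht]]].
  exists (fun y => / a * y + - c / a). repeat split.
  - exists (/ a), (- c / a). split; [now apply Rinv_0_lt_compat | easy].
  - intros y. rewrite Ht. field. lra.
  - intros y. rewrite Ht. field. lra.
Qed.

Lemma in_T2_lt (t : R -> R) (x y : R) : in_T2 t -> x < y -> t x < t y.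
Proof.
  intros [a [c [Ha Ht]]] Hxy. rewrite !Ht.
  apply Rplus_lt_compat_r. now apply Rmult_lt_compat_l.
Qed.

Lemma in_T2_lt_inv (t : R -> R) (x y : R) : in_T2 t -> t x < t y -> x < y.
Proof.
  intros Ht H. destruct (Rtotal_order x y) as [Hlt | [-> | Hgt]]; try lra.
  pose proof (in_T2_lt t y x Ht Hgt). lra.
Qed.

(** * Matching and self-similarity below a point *)

Definition matches {S : Type} (h : R -> S) (r : R -> R) (f : R -> S) (x : R) :=
  in_T2 r /\ forall u, u < x -> h (r u) = f u.

Definition shrinks {S : Type} (f : R -> S) (x : R) (t : R -> R) :=
  matches f t f x /\ t x < x.

Lemma matches_congr {S : Type} (h : R -> S) (r : R -> R) (f g : R -> S) (x : R) :
  (forall u, u < x -> f u = g u) -> matches h r f x -> matches h r g x.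
Proof.
  intros Hfg [Hr H]. split; [easy |]. intros u Hu. now rewrite H, Hfg.
Qed.

Lemma matches_le {S : Type} (h : R -> S) (r : R -> R) (f : R -> S) (x y : R) :
  x <= y -> matches h r f y -> matches h r f x.
Proof. intros Hxy [Hr H]. split; [easy |]. intros u Hu. apply H. lra. Qed.

Lemma matches_comp {S : Type} (h : R -> S) (r : R -> R) (f : R -> S)
    (t : R -> R) (x : R) :
  in_T2 t -> matches h r f (t x) ->
  matches h (fun u => r (t u)) (fun u => f (t u)) x.
Proof.
  intros Ht [Hr H]. split; [now apply in_T2_comp |].
  intros u Hu. apply H. now apply in_T2_lt.
Qed.

Lemma shrinks_congr {S : Type} (f g : R -> S) (x : R) (t : R -> R) :
  (forall u, u < x -> f u = g u) -> shrinks f x t -> shrinks g x t.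
Proof.
  intros Hfg [[Ht H] Htx]. split; [| easy]. split; [easy |].
  intros u Hu. rewrite <- !Hfg; auto.
  pose proof (in_T2_lt t u x Ht Hu). lra.
Qed.

(** Conjugation by [r], whose inverse is [q]. It carries the self-similar case along when a scenario
    is composed with an affine map, as anonymity requires. *)
Lemma shrinks_conj {S : Type} (f : R -> S) (x : R) (t r q : R -> R) :
  in_T2 r -> in_T2 q -> (forall y, r (q y) = y) -> (forall y, q (r y) = y) ->
  shrinks f (r x) t ->
  shrinks (fun u => f (r u)) x (fun u => q (t (r u))).
Proof.
  intros Hr Hq Hrq Hqr [[Ht H] Htx]. split.
  - split.
    + apply (in_T2_comp q (fun u => t (r u)) Hq). now apply in_T2_comp.
    + intros u Hu. rewrite Hrq. apply H. now apply in_T2_lt.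
  - rewrite <- (Hqr x) at 2. now apply in_T2_lt.
Qed.

(* With [X] and [X - D] the images of [x] under the two compositions, [f] has
   period [e = D / (a c)] on [(-oo, x)] and period [D] on [(-oo, X)]; hence
   [f X = f (X - e) = f (X - e - D) = f (X - D)]. *)
Lemma shrinks_value_aux {S : Type} (f : R -> S) (x a b c d : R) :
  0 < a -> 0 < c -> a * x + b < x -> c * x + d < x ->
  (forall u, u < x -> f (a * u + b) = f u) ->
  (forall u, u < x -> f (c * u + d) = f u) ->
  c * b + d < a * d + b ->
  f (a * x + b) = f (c * x + d).
Proof.
  intros Ha Hc Hax Hcx Fa Fc HD.
  assert (La : forall u, u < x -> a * u + b < x) by (intros; nra).
  assert (Lc : forall u, u < x -> c * u + d < x) by (intros; nra).
  set (D := a * d + b - (c * b + d)).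
  set (X := a * (c * x + d) + b).
  assert (Hac : 0 < a * c) by now apply Rmult_lt_0_compat.
  assert (HX : X < x) by (unfold X; auto).
  assert (HD0 : 0 < D) by (unfold D; lra).
  assert (He : 0 < D / (a * c)) by now apply Rdiv_lt_0_compat.
  assert (Fac : forall u, u < x -> f (a * c * u + (a * d + b)) = f u).
  { intros u Hu. replace (a * c * u + (a * d + b)) with (a * (c * u + d) + b) by ring.
    rewrite Fa; auto. }
  assert (Fca : forall u, u < x -> f (a * c * u + (a * d + b) - D) = f u).
  { intros u Hu. unfold D.
    replace (a * c * u + (a * d + b) - (a * d + b - (c * b + d)))
      with (c * (a * u + b) + d) by ring.
    rewrite Fc; auto. }
  assert (Pe : forall w, w < x -> f (w - D / (a * c)) = f w).
  { intros w Hw. rewrite <- (Fac (w - D / (a * c))) by lra. rewrite <- (Fca w Hw).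
    f_equal. field. lra. }
  assert (PD : forall w, w < X -> f (w - D) = f w).
  { intros w Hw. set (z := (w - (a * d + b)) / (a * c)).
    assert (Hwz : w = a * c * z + (a * d + b)) by (unfold z; field; lra).
    assert (Hz : z < x).
    { apply (Rmult_lt_reg_l (a * c)); [easy |]. unfold X in Hw. lra. }
    rewrite Hwz at 1. rewrite Hwz at 1. now rewrite Fca, Fac. }
  rewrite <- (Fc (a * x + b)) by lra. rewrite <- (Fa (c * x + d)) by lra. fold X.
  replace (c * (a * x + b) + d) with (X - D) by (unfold X, D; ring).
  rewrite <- (Pe X), <- (Pe (X - D)) by lra.
  replace (X - D - D / (a * c)) with (X - D / (a * c) - D) by ring.
  apply PD. lra.
Qed.

(** The two compositions of the maps have the same slope, so they differ by a translation. If it is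
    trivial, the maps commute and both values equal [f] at the common image of [x]; otherwise its
    sign decides in which order the auxiliary lemma takes the maps. *)
Lemma shrinks_value {S : Type} (f : R -> S) (x : R) (s t : R -> R) :
  shrinks f x s -> shrinks f x t -> f (s x) = f (t x).
Proof.
  intros [[[a [b [Ha Hs]]] Fs] Hsx] [[[c [d [Hc Ht]]] Ft] Htx].
  rewrite Hs in Hsx |- *. rewrite Ht in Htx |- *.
  assert (Fa : forall u, u < x -> f (a * u + b) = f u)
    by (intros; rewrite <- Hs; auto).
  assert (Fc : forall u, u < x -> f (c * u + d) = f u)
    by (intros; rewrite <- Ht; auto).
  destruct (Rtotal_order (c * b + d) (a * d + b)) as [H | [H | H]].
  - now apply shrinks_value_aux.
  - rewrite <- (Fc (a * x + b)), <- (Fa (c * x + d)) by lra.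
    f_equal. replace (c * (a * x + b) + d) with (c * a * x + (c * b + d)) by ring.
    rewrite H. ring.
  - symmetry. now apply shrinks_value_aux.
Qed.

(* If [t y < y] and [t] does not fix [x], then [t] or its inverse moves [x] to
   the left while preserving [f] below [x]. *)
Lemma shrinks_before {S : Type} (f : R -> S) (x y : R) (t : R -> R) :
  shrinks f y t -> x < y -> t x <> x ->
  exists s, shrinks f x s /\ f (s x) = f x.
Proof.
  intros [[Ht F] Hty] Hxy Hne.
  destruct (Rtotal_order (t x) x) as [H | [H | H]]; [| easy |].
  - exists t. split; [| now apply F]. split; [| easy].
    apply (matches_le f t f x y); [lra | easy].
  - destruct (in_T2_inv t Ht) as [r [Hr [Htr Hrt]]].
    assert (Hrx : r x < x).
    { apply (in_T2_lt_inv t); [easy |]. now rewrite Htr. }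
    exists r. repeat split; auto.
    + intros u Hu. rewrite <- (F (r u)), Htr; [easy |].
      pose proof (in_T2_lt r u x Hr Hu). lra.
    + rewrite <- (F (r x)), Htr; [easy | lra].
Qed.

(** If [r x < s x], then [r] followed by the inverse of [s] moves [x] to the left, and it preserves
    [f] below [x] because both maps read [f] off the same [h]. *)
Lemma matches_value {S : Type} (h f : R -> S) (x : R) (r s : R -> R) :
  matches h r f x -> matches h s f x ->
  h (r x) = h (s x) \/ exists t, shrinks f x t.
Proof.
  assert (Aux : forall r s, matches h r f x -> matches h s f x -> r x < s x ->
    exists t, shrinks f x t).
  { clear r s. intros r s [Hr Fr] [Hs Fs] Hrs.
    destruct (in_T2_inv s Hs) as [q [Hq [Hsq Hqs]]].
    assert (L : forall u, u <= x -> q (r u) < x).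
    { intros u Hu. rewrite <- (Hqs x). apply in_T2_lt; [easy |].
      destruct Hu as [Hu | ->]; [| easy].
      pose proof (in_T2_lt r u x Hr Hu). lra. }
    exists (fun u => q (r u)). repeat split.
    - now apply in_T2_comp.
    - intros u Hu. rewrite <- Fs, Hsq; [auto |]. apply L. lra.
    - apply L. lra. }
  intros Hr Hs. destruct (Rtotal_order (r x) (s x)) as [H | [-> | H]].
  - right. eauto.
  - now left.
  - right. eauto.
Qed.

(** * Well-orderings of an arbitrary type *)

Lemma well_order_exists (T : Type) :
  exists le : T -> T -> Prop,
    (forall x y, le x y -> le y x -> x = y) /\
    forall A : T -> Prop, (exists x, A x) ->
      exists m, A m /\ forall y, A y -> le m y.
Proof.
  (* The principle is stated for types with decidable equality and boolean predicates; [gen_eqMixin]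
     and [asbool] supply both classically. *)
  destruct (wochoice.well_ordering_principle
    (eqtype.Equality.Pack (eqtype.Equality.Class (boolp.gen_eqMixin T))))
    as [r Hr].
  assert (Hmin : forall A : T -> Prop, (exists x, A x) ->
    exists! m, A m /\ forall y, A y -> r m y = true).
  { intros A [x Ax].
    destruct (Hr (fun z => boolp.asbool (A z))) as [m [[Am Hm] Um]].
    - exists x. now apply (ssrbool.introT (boolp.asboolP _)).
    - exists m. split; [split |].
      + now apply (ssrbool.elimT (boolp.asboolP _)).
      + intros y Ay. apply Hm. now apply (ssrbool.introT (boolp.asboolP _)).
      + intros y [Ay Hy]. apply Um. split.
        * now apply (ssrbool.introT (boolp.asboolP _)).
        * intros z Az. apply Hy. now apply (ssrbool.elimT (boolp.asboolP _)). }
  exists (fun x y => r x y = true). split.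
  - assert (Refl : forall x, r x x = true).
    { intros x. destruct (Hmin (eq x)) as [m [[<- Hm] _]]; eauto. }
    intros x y Hxy Hyx.
    (* Under the two hypotheses [x] and [y] are both minimal in the pair, so uniqueness of the
       minimum identifies them. *)
    destruct (Hmin (fun z => z = x \/ z = y)) as [m [_ Um]]; [eauto |].
    transitivity m; [symmetry |]; apply Um; (split; [auto |]);
      intros z [-> | ->]; auto.
  - intros A HA. destruct (Hmin A HA) as [m [Hm _]]. eauto.
Qed.

(** * Countability criteria for sets of reals *)

Definition nth_rational (n : nat) : R :=
  let (m, k) := Cantor.of_nat n in
  let (a, b) := Cantor.of_nat m in
  (INR a - INR b) / INR (S k).

Lemma nth_rational_dense (x y : R) :
  x < y -> exists n, x < nth_rational n < y.
Proof.
  intros Hxy.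
  destruct (INR_archimed (y - x) 1) as [k Hk]; [lra |].
  assert (Hk0 : 0 < INR (S k)) by (apply lt_0_INR; lia).
  assert (HS : INR (S k) = INR k + 1) by apply S_INR.
  destruct (archimed (x * INR (S k))) as [H1 H2].
  set (p := up (x * INR (S k))) in *.
  (* The fraction [p / S k] exceeds [x] by at most [1 / S k], which is less than [y - x]. The
     integer [p] is the difference of two truncations, of which at least one is zero. *)
  exists (Cantor.to_nat (Cantor.to_nat (Z.to_nat p, Z.to_nat (- p)), k)).
  unfold nth_rational. rewrite !Cantor.cancel_of_to, !INR_IZR_INZ, <- minus_IZR.
  replace (Z.of_nat (Z.to_nat p) - Z.of_nat (Z.to_nat (- p)))%Z with p by lia.
  rewrite <- INR_IZR_INZ.
  assert (Hq : IZR p / INR (S k) * INR (S k) = IZR p) by (field; lra).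
  split; apply (Rmult_lt_reg_r (INR (S k))); try easy; rewrite Hq; nra.
Qed.

(** Each point is labelled by a rational in the gap to its right. For [x < y] in [A], the label of
    [x] lies below [y] and that of [y] above it, so labels are distinct. *)
Lemma countable_right_isolated (A : R -> Prop) :
  (forall x, A x -> exists y, x < y /\ forall z, A z -> x < z -> y <= z) ->
  countable_set A.
Proof.
  intros H.
  destruct (functional_choice (fun x n => A x ->
    x < nth_rational n /\ forall z, A z -> x < z -> nth_rational n < z))
    as [g Hg].
  { intros x. destruct (classic (A x)) as [Ax | Nx]; [| now exists 0%nat].
    destruct (H x Ax) as [y [Hxy Hy]].
    destruct (nth_rational_dense x y Hxy) as [n [Hn1 Hn2]].
    exists n. intros _. split; [easy |].
    intros z Az Hz. pose proof (Hy z Az Hz). lra. }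
  exists g. intros x y Ax Ay Hxy.
  destruct (Hg x Ax) as [Lx Ux], (Hg y Ay) as [Ly Uy].
  rewrite Hxy in Lx, Ux.
  destruct (Rtotal_order x y) as [L | [E | L]]; [| easy |].
  - pose proof (Ux y Ay L). lra.
  - pose proof (Uy x Ax L). lra.
Qed.

Lemma countable_union (A B C : R -> Prop) :
  (forall x, C x -> A x \/ B x) ->
  countable_set A -> countable_set B -> countable_set C.
Proof.
  intros HC [g Hg] [h Hh].
  destruct (functional_choice (fun x n =>
    (A x /\ n = (2 * g x)%nat) \/ (~ A x /\ n = (2 * h x + 1)%nat)))
    as [k Hk].
  { intros x. destruct (classic (A x)); eauto. }
  exists k. intros x y Cx Cy Hxy.
  destruct (HC x Cx), (HC y Cy), (Hk x) as [[? ?] | [? ?]],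
    (Hk y) as [[? ?] | [? ?]]; try tauto; try lia;
    solve [apply Hg; auto; lia | apply Hh; auto; lia].
Qed.

Lemma countable_no_three (A : R -> Prop) :
  (forall x y z, A x -> A y -> A z -> x < y -> y < z -> False) ->
  countable_set A.
Proof.
  intros H. apply countable_right_isolated. intros x Ax.
  destruct (classic (exists y, A y /\ x < y)) as [[y [Ay Hxy]] | N].
  - exists y. split; [easy |]. intros z Az Hxz.
    destruct (Rle_or_lt y z); [easy |]. exfalso. eauto.
  - exists (x + 1). split; [lra |]. intros z Az Hz. exfalso. eauto.
Qed.

(** * The prediction and its errors *)

Section Prediction.

Context {S : Type} (le : (R -> S) -> (R -> S) -> Prop).

Definition least_match (f : R -> S) (x : R) (h : R -> S) : Prop :=
  (exists r, matches h r f x) /\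
  forall k r, matches k r f x -> le h k.

(** A relation instead of a function: locality and equivariance are then proved without fixing [t]
    or [r], and a function is extracted only at the end. *)
Definition predicts (f : R -> S) (x : R) (v : S) : Prop :=
  (exists t, shrinks f x t /\ v = f (t x)) \/
  ((forall t, ~ shrinks f x t) /\
   exists h r, least_match f x h /\ matches h r f x /\ v = h (r x)).

Lemma predicts_congr (f g : R -> S) (x : R) (v : S) :
  (forall u, u < x -> f u = g u) -> predicts f x v -> predicts g x v.
Proof.
  intros Hfg.
  assert (Hgf : forall u, u < x -> g u = f u) by (intros; symmetry; auto).
  intros [[t [Ht ->]] | [N [h [r [[_ Hh] [Hr ->]]]]]].
  - left. exists t. split; [now apply (shrinks_congr f) |].
    apply Hfg, Ht.
  - right. split.
    + intros t Ht. apply (N t). now apply (shrinks_congr g).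
    + assert (Hr' : matches h r g x) by now apply (matches_congr h r f).
      exists h, r. repeat split; try apply Hr'; eauto.
      intros k q Hk. apply (Hh k q). now apply (matches_congr k q g).
Qed.

(** Conjugation by [t] handles the first case. In the second, the same scenarios match [f] at [t x]
    and [f o t] at [x], so the least one is unchanged, and [r] becomes [r o t]. *)
Lemma predicts_comp (f : R -> S) (t : R -> R) (x : R) (v : S) :
  in_T2 t -> predicts f (t x) v -> predicts (fun u => f (t u)) x v.
Proof.
  intros Ht. destruct (in_T2_inv t Ht) as [q [Hq [Htq Hqt]]].
  assert (Ef : (fun u => f (t (q u))) = f)
    by (extensionality u; now rewrite Htq).
  intros [[s [Hs ->]] | [N [h [r [[_ Hh] [Hr ->]]]]]].
  - left. exists (fun u => q (s (t u))). split.
    + now apply shrinks_conj.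
    + now rewrite Htq.
  - right. split.
    (* Transport back along the inverse [q], reading [f] as [(f o t) o q]. *)
    + intros s Hs. apply (N (fun u => t (s (q u)))). rewrite <- Ef.
      apply (shrinks_conj (fun u => f (t u))); auto. now rewrite Hqt.
    + assert (Hr' := matches_comp h r f t x Ht Hr).
      exists h, (fun u => r (t u)). repeat split; try apply Hr'; eauto.
      intros k s Hk. apply (Hh k (fun u => s (q u))). rewrite <- Ef.
      apply (matches_comp k s (fun u => f (t u))); auto. now rewrite Hqt.
Qed.

Hypothesis le_antisym : forall h k, le h k -> le k h -> h = k.

Hypothesis le_least : forall A : (R -> S) -> Prop,
  (exists h, A h) -> exists m, A m /\ forall k, A k -> le m k.

Lemma least_match_exists (f : R -> S) (x : R) : exists h, least_match f x h.
Proof.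
  destruct (le_least (fun h => exists r, matches h r f x)) as [h [Hh Hm]].
  - exists f, (fun y => y). split; [exact in_T2_id | easy].
  - exists h. split; [easy |]. intros k r Hk. eauto.
Qed.

Lemma predicts_exists (f : R -> S) (x : R) : exists v, predicts f x v.
Proof.
  destruct (classic (exists t, shrinks f x t)) as [[t Ht] | N].
  - exists (f (t x)). left. eauto.
  - destruct (least_match_exists f x) as [h Hh].
    pose proof Hh as [[r Hr] _].
    exists (h (r x)). right. split; [intros t Ht |]; eauto 6.
Qed.

Lemma predicts_unique (f : R -> S) (x : R) (v w : S) :
  predicts f x v -> predicts f x w -> v = w.
Proof.
  intros [[s [Hs ->]] | [N [h [r [[_ Hh] [Hr ->]]]]]]
    [[t [Ht ->]] | [M [k [q [[_ Hk] [Hq ->]]]]]].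
  - now apply shrinks_value.
  - now destruct (M s).
  - now destruct (N t).
  - assert (h = k) as <- by eauto.
    destruct (matches_value h f x r q Hr Hq) as [E | [t Ht]]; [easy |].
    now destruct (N t).
Qed.

(** Among three errors, the map [t] at the largest must fix the two smaller ones, since moving one
    would yield a correct prediction there. An affine map with two fixed points is the identity,
    contradicting [t z < z]. *)
Lemma shrinking_errors_countable (f : R -> S) :
  countable_set (fun x => (exists t, shrinks f x t) /\ ~ predicts f x (f x)).
Proof.
  apply countable_no_three.
  intros x y z [_ Ex] [_ Ey] [[t Ht] _] Hxy Hyz.
  assert (Fix : forall w, w < z -> ~ predicts f w (f w) -> t w = w).
  { intros w Hw Ew. destruct (Req_dec (t w) w) as [E | Ne]; [easy |].
    destruct (shrinks_before f w z t Ht Hw Ne) as [s [Hs E]].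
    destruct Ew. left. eauto. }
  assert (Fx : t x = x) by (apply Fix; [lra | easy]).
  assert (Fy : t y = y) by now apply Fix.
  destruct Ht as [[[a [c [Ha Ht]]] _] Hz].
  rewrite Ht in Fx, Fy, Hz. nra.
Qed.

Lemma matching_errors_countable (f : R -> S) :
  countable_set
    (fun x => (forall t, ~ shrinks f x t) /\ ~ predicts f x (f x)).
Proof.
  destruct (functional_choice (least_match f) (least_match_exists f)) as [m Hm].
  assert (Mono : forall x y, x < y -> le (m x) (m y)).
  { intros x y Hxy. destruct (Hm y) as [[r Hr] _].
    apply (Hm x) with r. apply (matches_le _ _ _ x y); [lra | easy]. }
  (* A match at [y] also covers the point [x]; if it used the scenario [m x], the prediction at [x]
     would be correct. *)
  assert (Strict : forall x y, x < y ->
    (forall t, ~ shrinks f x t) -> ~ predicts f x (f x) -> m x <> m y).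
  { intros x y Hxy N Ex E. destruct Ex. right. split; [easy |].
    destruct (Hm y) as [[r Hr] _]. rewrite <- E in Hr.
    exists (m x), r. repeat split; try apply Hm.
    - apply Hr.
    - intros u Hu. apply Hr. lra.
    - symmetry. now apply Hr. }
  apply countable_right_isolated. intros x _.
  set (A := fun x => (forall t, ~ shrinks f x t) /\ ~ predicts f x (f x)).
  destruct (classic (exists y, A y /\ x < y)) as [[y [Ay Hxy]] | None].
  (* The later error with least [m] is the next error after [x], hence the right end of a gap. *)
  - destruct (le_least (fun h => exists z, A z /\ x < z /\ h = m z))
      as [h [[z [Az [Hxz ->]]] Hz]]; [eauto 6 |].
    exists z. split; [easy |]. intros w Aw Hxw.
    destruct (Rle_or_lt z w) as [L | L]; [easy |].
    (* An error [w] between [x] and [z] would have [m w = m z]: one inequality by monotonicity, the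
       other by minimality. *)
    destruct Aw as [Nw Ew]. destruct (Strict w z L Nw Ew).
    apply le_antisym; [now apply Mono |].
    apply Hz. exists w. now repeat split.
  - exists (x + 1). split; [lra |]. intros z Az Hz. destruct None. now exists z.
Qed.

End Prediction.

Theorem theorem2 :
  forall S : Type,
    exists P : (R -> S) -> (R -> S),
      predictor P /\ anonymous in_T2 P /\
      forall f : R -> S, countable_set (fun x => P f x <> f x).
Proof.
  intros S.
  destruct (well_order_exists (R -> S)) as [le [Hanti Hleast]].
  pose proof (predicts_unique le Hanti) as Huniq.
  (* Values are chosen independently for each scenario and point; uniqueness makes them coherent. *)
  destruct (functional_choice (fun f g => forall x, predicts le f x (g x))) as [P HP].
  { intros f. apply (functional_choice (predicts le f)). now apply predicts_exists. }
  exists P. repeat split.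
  - intros f g x Hfg. apply (Huniq g x); [| apply HP].
    now apply (predicts_congr le f).
  - intros f t Ht. extensionality x.
    apply (Huniq (fun u => f (t u)) x); [apply HP |].
    now apply predicts_comp.
  - intros f.
    apply (countable_union _ _ _) with
      (2 := shrinking_errors_countable le f)
      (3 := matching_errors_countable le Hanti Hleast f).
    intros x Hx.
    assert (E : ~ predicts le f x (f x)) by (intros E; apply Hx; eauto).
    destruct (classic (exists t, shrinks f x t)) as [? | N]; [now left |].
    right. split; [| easy]. intros t Ht. eauto.
Qed.
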